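(* Let $k$ be a field of characteristic zero, let $i \ge 2$, and let $S_i = k[X, Y_1, \ldots, Y_i]/\left(X^2, (Y_1, \ldots, Y_i)^2\right)$. For a positive integer $n$, let $\mathcal{TR}_n(S_i)$ be the set of isomorphism classes of totally reflexive $S_i$-modules which have no nonzero projective summands and which are minimally generated by $n$ elements. Let $\mathrm{M}_n(k)^i$ be the set of $i$-tuples of $n \times n$ matrices with entries in $k$, and let $\sim$ be the equivalence relation on $\mathrm{M}_n(k)^i$ given by $(A_1, \dots, A_i) \sim (B_1, \dots, B_i)$ if there exists $P \in \mathrm{GL}_n(k)$ such that $(PA_1P^{-1}, \dots, PA_iP^{-1}) = (B_1, \dots, B_i)$. Then there exists a bijection $$\vartheta : \mathcal{TR}_n(S_i) \longleftrightarrow \mathrm{M}_n(k)^i/\!\sim .$$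
   Context: Here $(Y_1,\ldots,Y_i)^2$ denotes the square of the ideal $(Y_1,\dots,Y_i)$, so $S_i$ is a commutative Artinian local ring. A finitely generated module $M$ over a commutative Noetherian ring $R$ is called totally reflexive if $\operatorname{Ext}_R^j(M,R)=0$ and $\operatorname{Ext}_R^j(\operatorname{Hom}_R(M,R),R)=0$ for all $j>0$, and the biduality map $M \to \operatorname{Hom}_R(\operatorname{Hom}_R(M,R),R)$ is an isomorphism. *)

(* Defs.v *)
From HB Require Import structures.
From mathcomp Require Import all_boot all_order all_algebra.
From mathcomp Require Import ring_quotient.
From mathcomp Require Import boolp classical_sets functions.
From mathcomp Require Import mpoly.

Set Implicit Arguments.
Unset Strict Implicit.
Unset Printing Implicit Defensive.
Import GRing.Theory.
Local Open Scope ring_scope.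

Section Ideals.
Variable R : comNzRingType.
Implicit Types (G I J : set R).

Definition ideal_gen G : set R := fun x =>
  exists2 s : seq (R * R),
    (forall p, p \in s -> G p.2) & x = \sum_(p <- s) p.1 * p.2.

Definition ideal_mul I J : set R :=
  ideal_gen (fun z => exists x y, [/\ I x, J y & z = x * y]).

Lemma ideal_gen_sub G (x : R) : G x -> ideal_gen G x.
Proof.
move=> Gx; exists [:: (1, x)]; last by rewrite big_seq1 mul1r.
by move=> p; rewrite inE => /eqP->.
Qed.

Lemma ideal_gen0 G : ideal_gen G 0.
Proof. by exists [::] => //; rewrite big_nil. Qed.

Lemma ideal_genMD G (a u v : R) :
  ideal_gen G u -> ideal_gen G v -> ideal_gen G (a * u + v).
Proof.
case=> [s Gs ->] [t Gt ->]; exists ([seq (a * p.1, p.2) | p <- s] ++ t).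
  move=> p; rewrite mem_cat => /orP[/mapP[q qs ->]|]; last exact: Gt.
  exact: (Gs q qs).
rewrite big_cat big_map; congr (_ + _); rewrite mulr_sumr.
by apply: eq_bigr => p _; rewrite mulrA.
Qed.

Lemma ideal_gen_ker (R' : pzRingType) (f : {rmorphism R -> R'}) G :
  (forall x, G x -> f x = 0) -> forall x, ideal_gen G x -> f x = 0.
Proof.
move=> G0 x [s Gs ->]; rewrite rmorph_sum big_seq big1 // => p ps.
by rewrite rmorphM (G0 _ (Gs _ ps)) mulr0.
Qed.

End Ideals.

(* S_i = k[X, Y_1, ..., Y_i] / (X^2, (Y_1, ..., Y_i)^2): the variable
   of index 0 plays the role of X, the other i variables are the Y_j. *)
Section RingS.
Variables (k : fieldType) (i : nat).
Local Notation P := {mpoly k[i.+1]}.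

Definition varX : P := 'X_ord0.
Definition varY (j : 'I_i) : P := 'X_(lift ord0 j).

Definition idealY : set P := ideal_gen (fun p => exists j, p = varY j).

Definition relS : set P :=
  ideal_gen (fun p => p = varX ^+ 2 \/ ideal_mul idealY idealY p).

(* Ring quotients by an ideal require a boolean membership predicate. *)
Definition relSb : {pred P} := fun p => `[< relS p >].

Lemma relSb_idealr : idealr_closed relSb.
Proof.
split.
- by apply/asboolP; exact: ideal_gen0.
- apply/negP => /asboolP r1.
  pose ev : {rmorphism P -> k} := meval (fun=> 0).
  suff /eqP : ev 1 = 0 by rewrite rmorph1 oner_eq0.
  have evY : forall y, idealY y -> ev y = 0.
    by apply: ideal_gen_ker => y [j ->]; rewrite /ev /= mevalXU.
  move: 1 r1; apply: ideal_gen_ker => x [->|].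
    by rewrite rmorphXn /= mevalXU expr0n.
  move: x; apply: ideal_gen_ker => x [y [z [Yy _ ->]]].
  by rewrite rmorphM evY ?mul0r.
- move=> a u v /asboolP ru /asboolP rv.
  by apply/asboolP; exact: ideal_genMD.
Qed.

HB.instance Definition _ := isIdealr.Build P relSb relSb_idealr.

Definition ringS : comNzRingType := {ideal_quot relSb : idealr P}.

End RingS.

Section Modules.
Variable R : comNzRingType.
Implicit Types M N P Q : lmodType R.

Definition lmod_iso M N : Prop := exists f : {linear M -> N}, bijective f.

Definition generates M m (g : 'I_m -> M) : Prop :=
  forall x, exists c : 'I_m -> R, x = \sum_j c j *: g j.

Definition generated_by M m : Prop := exists g : 'I_m -> M, generates g.

Definition fin_gen M : Prop := exists m, generated_by M m.

Definition min_generated_by M n : Prop :=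
  generated_by M n /\ forall m, generated_by M m -> (n <= m)%N.

Definition projective P : Prop :=
  forall (A B : lmodType R) (g : {linear A -> B}) (f : {linear P -> B}),
    (forall b, exists a, g a = b) ->
    exists h : {linear P -> A}, forall x, g (h x) = f x.

Definition no_proj_summand M : Prop :=
  forall P Q, lmod_iso M (P * Q)%type -> projective P -> forall x : P, x = 0.

Definition is_linear M N : {pred M -> N} := fun f => `[< linear f >].

Lemma is_linear_submod M N : submod_closed (@is_linear M N).
Proof.
split=> [|a f g /asboolP lf /asboolP lg]; apply/asboolP => b x y /=.
  by rewrite scaler0 addr0.
rewrite -[LHS]/(a *: f (b *: x + y) + g (b *: x + y)).
rewrite -[RHS]/(b *: (a *: f x + g x) + (a *: f y + g y)) lf lg.
by rewrite !scalerDr !scalerA (mulrC a b) addrACA.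
Qed.

HB.instance Definition _ M N :=
  GRing.isSubmodClosed.Build R (M -> N) (@is_linear M N) (@is_linear_submod M N).

Record lin_hom M N := LinHom { lin_hom_val :> M -> N; _ : lin_hom_val \in @is_linear M N }.

HB.instance Definition _ M N := [isSub for @lin_hom_val M N].
HB.instance Definition _ M N := [Choice of lin_hom M N by <:].
HB.instance Definition _ M N := [SubChoice_isSubLmodule of lin_hom M N by <:].

Definition dual_mod M : lmodType R := lin_hom M R^o.

Fact eval_linear M (x : M) : (fun phi : dual_mod M => phi x) \in @is_linear (dual_mod M) R^o.
Proof. by apply/asboolP. Qed.

Definition biduality M (x : M) : dual_mod (dual_mod M) := LinHom (eval_linear x).

Fact biduality_linear M : linear (@biduality M).
Proof.
move=> a x y; apply: val_inj; apply/funext => phi /=.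
by have /asboolP phi_lin := valP phi; exact: phi_lin.
Qed.

Record proj_resolution M := ProjResolution {
  res :> nat -> lmodType R;
  res_d : forall j, {linear res j.+1 -> res j};
  res_aug : {linear res 0%N -> M};
  res_proj : forall j, projective (res j);
  res_aug_surj : forall x, exists y, res_aug y = x;
  res_exact0 : forall y, res_aug y = 0 <-> exists z, res_d 0%N z = y;
  res_exactS : forall j y, res_d j y = 0 <-> exists z, res_d j.+1 z = y
}.

(* Ext_R^j(M, N) = 0, where Ext_R^j(M, N) is the j-th cohomology of Hom_R(F, N)
   for a projective resolution F of M; by the comparison theorem the vanishing
   does not depend on F. *)
Definition cocycle M N (F : proj_resolution M) j (f : {linear F j -> N}) : Prop :=
  forall z, f (res_d F j z) = 0.

Definition coboundary M N (F : proj_resolution M) j : {linear F j -> N} -> Prop :=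
  match j with
  | 0%N => fun f => forall x, f x = 0
  | j'.+1 => fun f => exists g : {linear F j' -> N}, forall x, f x = g (res_d F j' x)
  end.

Definition Ext_eq0 j M N : Prop :=
  exists F : proj_resolution M,
    forall f : {linear F j -> N}, cocycle f -> coboundary f.

Definition totally_reflexive M : Prop :=
  [/\ fin_gen M,
      forall j, (0 < j)%N -> Ext_eq0 j M R^o,
      forall j, (0 < j)%N -> Ext_eq0 j (dual_mod M) R^o
    & bijective (@biduality M)].

End Modules.

(* The quotient T / E for an equivalence relation E, with the class of x encoded
   as the predicate E x.  It is used instead of {eq_quot _} because it also makes
   sense when T is a type of modules, which carries no choiceType. *)
Definition classes (T : Type) (E : T -> T -> Prop) : Type :=
  {C : T -> Prop | exists x, C = E x}.

Definition TRmod (k : fieldType) (i n : nat) : Type :=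
  {M : lmodType (ringS k i) |
    [/\ totally_reflexive M, no_proj_summand M & min_generated_by M n]}.

Definition TR (k : fieldType) (i n : nat) : Type :=
  classes (fun M N : TRmod k i n => lmod_iso (sval M) (sval N)).

Definition sim_conj (k : fieldType) (i n : nat) (A B : {ffun 'I_i -> 'M[k]_n}) : Prop :=
  exists2 P : 'M[k]_n, P \in unitmx & forall j, P *m A j *m invmx P = B j.

(* Main.v *)
(* Write Q = k[Y]/(Y)^2, so that R = ringS k i = Q + xQ is free over Q.  A tuple A of
   matrices gives N = sum_j y_j A_j with N^2 = 0, and the matrices x + N and x - N
   form an exact pair: over Q, ker (x + N) = im (x - N).  Hence the module
   MA A = im (x + N) = ker (x - N) has a 2-periodic resolution; its dual is the
   module of the transposed tuple, and it is totally reflexive.  Comparing the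
   coefficients of x y_j shows that MA A and MA B are isomorphic iff A and B are
   conjugate.

   Conversely, a finitely generated M with Ext^2(M, R) = 0 is free over Q.  Over Q this
   says that the first syzygy K of a minimal cover satisfies Ext^1_Q(K, Q) = 0; K is a
   k-vector space, whereas Ext^1_Q(k, Q) <> 0 because i >= 2: the Q-endomorphisms of
   (Y) do not all come from scalars.  The argument is run directly
   on an arbitrary R-projective resolution.  On M = Q^t, x acts by a matrix N over Q; a unit
   entry of N would make a row of x + N a surjection M -> R and split off a copy of R, so
   without projective summands N = sum_j y_j A_j and M is isomorphic to MA A. *)

From HB Require Import structures.
Require Import Defs.
From mathcomp Require Import all_boot all_order all_algebra.
From mathcomp Require Import ring_quotient.
From mathcomp Require Import boolp classical_sets functions.
From mathcomp Require Import mpoly.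
From mathcomp Require Import ring.

Set Implicit Arguments.
Unset Strict Implicit.
Unset Printing Implicit Defensive.
Import GRing.Theory.
Local Open Scope ring_scope.

(** * Coordinates on the ring *)

Section Coordinates.
Variables (k : fieldType) (i : nat).
Local Notation P := {mpoly k[i.+1]}.
Local Notation R := (ringS k i).

Definition piS (p : P) : R := \pi_(R)%qT p.

Fact piS_zmod : zmod_morphism piS. Proof. exact: rmorphB. Qed.
Fact piS_monoid : monoid_morphism piS. 
Proof. by split=> [|p q]; rewrite /piS ?rmorph1 ?rmorphM. Qed.
HB.instance Definition _ := GRing.isZmodMorphism.Build P R piS piS_zmod.
HB.instance Definition _ := GRing.isMonoidMorphism.Build P R piS piS_monoid.

Lemma piS_surj (s : R) : exists p, piS p = s.
Proof. by exists (repr s); exact: reprK. Qed.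

Lemma piS_eq0 p : piS p = 0 <-> relS p.
Proof.
rewrite -(rmorph0 piS); split.
  by move/eqP; rewrite -Quotient.idealrBE subr0 => /asboolP.
by move=> rp; apply/eqP; rewrite -Quotient.idealrBE subr0; apply/asboolP.
Qed.

Definition piC (a : k) : R := piS a%:MP.

Fact piC_zmod : zmod_morphism piC.
Proof. by move=> a b; rewrite /piC raddfB /= raddfB. Qed.
Fact piC_monoid : monoid_morphism piC.
Proof. by split=> [|a b]; rewrite /piC ?mpolyC1 ?mpolyCM ?rmorph1 ?rmorphM. Qed.
HB.instance Definition _ := GRing.isZmodMorphism.Build k R piC piC_zmod.
HB.instance Definition _ := GRing.isMonoidMorphism.Build k R piC piC_monoid.

Definition xS : R := piS (varX k i).
Definition yS (j : 'I_i) : R := piS (varY k j).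

(* The coefficients of 1, X, Y_j and X Y_j, as values at 0 of derivatives: the
   product rules then come from the Leibniz rule. *)
Definition ev0 (p : P) : k := p.@[fun=> 0].
Definition evX (p : P) : k := ev0 p^`M(ord0).
Definition evY (j : 'I_i) (p : P) : k := ev0 p^`M(lift ord0 j).
Definition evXY (j : 'I_i) (p : P) : k := ev0 p^`M(ord0)^`M(lift ord0 j).

Fact ev0_additive : zmod_morphism ev0. Proof. by move=> p q; rewrite /ev0 mevalB. Qed.
Fact evX_additive : zmod_morphism evX.
Proof. by move=> p q; rewrite /evX mderivB ev0_additive. Qed.
Fact evY_additive j : zmod_morphism (evY j).
Proof. by move=> p q; rewrite /evY mderivB ev0_additive. Qed.
Fact evXY_additive j : zmod_morphism (evXY j).
Proof. by move=> p q; rewrite /evXY !mderivB ev0_additive. Qed.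

HB.instance Definition _ := GRing.isZmodMorphism.Build P k ev0 ev0_additive.
HB.instance Definition _ := GRing.isZmodMorphism.Build P k evX evX_additive.
HB.instance Definition _ j := GRing.isZmodMorphism.Build P k (evY j) (evY_additive j).
HB.instance Definition _ j := GRing.isZmodMorphism.Build P k (evXY j) (evXY_additive j).

Lemma ev0M p q : ev0 (p * q) = ev0 p * ev0 q.
Proof. by rewrite /ev0 mevalM. Qed.

Lemma evXM p q : evX (p * q) = ev0 p * evX q + evX p * ev0 q.
Proof. by rewrite /evX mderivM raddfD /= !ev0M addrC. Qed.

Lemma evYM j p q : evY j (p * q) = ev0 p * evY j q + evY j p * ev0 q.
Proof. by rewrite /evY mderivM raddfD /= !ev0M addrC. Qed.

Lemma evXYM j p q : evXY j (p * q) =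
  ev0 p * evXY j q + evX p * evY j q + evY j p * evX q + evXY j p * ev0 q.
Proof.
rewrite /evXY mderivM !mderivD !mderivM !raddfD /= !ev0M /evX /evY.
ring.
Qed.

Definition evM := (ev0M, evXM, evYM, evXYM).

Lemma mderiv_var (a b : 'I_i.+1) : ('X_a : P)^`M(b) = (a == b)%:R%:MP.
Proof.
rewrite mderivX mnm1E; case: eqP => [->|_]; last by rewrite scale0r mpolyC0.
have -> : (U_(b) - U_(b))%MM = 0%MM by apply/mnmP => j; rewrite mnmBE subnn mnm0E.
by rewrite mpolyX0 scale1r mpolyC1.
Qed.

Lemma ev_varX : ((ev0 (varX k i) = 0) * (evX (varX k i) = 1))
  * ((forall j, evY j (varX k i) = 0) * (forall j, evXY j (varX k i) = 0)).
Proof.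
by (do 2!split) => [||j|j];
  rewrite /evX /evY /evXY /ev0 /varX ?mevalXU // !mderiv_var ?mderivC ?meval0 ?mevalC ?eqxx.
Qed.

Lemma ev_varY l : ((ev0 (varY k l) = 0) * (evX (varY k l) = 0))
  * ((forall j, evY j (varY k l) = (j == l)%:R) * (forall j, evXY j (varY k l) = 0)).
Proof.
by (do 2!split) => [||j|j];
  rewrite /evX /evY /evXY /ev0 /varY ?mevalXU // !mderiv_var ?mderivC ?meval0 ?mevalC
    // (inj_eq lift_inj) eq_sym.
Qed.

Lemma ev_C a : ((ev0 a%:MP = a) * (evX a%:MP = 0))
  * ((forall j, evY j a%:MP = 0) * (forall j, evXY j a%:MP = 0)).
Proof.
by (do 2!split) => [||j|j]; rewrite /evX /evY /evXY /ev0 ?mderivC ?meval0 ?mevalC //.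
Qed.

Definition ev_zero p := [/\ ev0 p = 0, evX p = 0, forall j, evY j p = 0
  & forall j, evXY j p = 0].

(** By the Leibniz rules each coefficient of [a * g] is a combination of coefficients of [g], so the
    polynomials on which all of them vanish form an ideal. *)
Lemma ev_zero_gen (G : set P) p : (forall g, G g -> ev_zero g) ->
  ideal_gen G p -> ev_zero p.
Proof.
move=> G0 [s Gs ->].
have {}Gs q : q \in s -> ev_zero (q.1 * q.2).
  move=> /Gs/G0[e0 eX eY eXY].
  by split=> [||j|j]; rewrite !evM !(e0, eX, eY, eXY) !mulr0 ?addr0.
split=> [||j|j]; rewrite raddf_sum big_seq big1 // => q /Gs[e0 eX eY eXY];
  first [exact: e0|exact: eX|exact: eY|exact: eXY].
Qed.

Lemma ev_rel p : relS p -> ev_zero p.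
Proof.
apply: ev_zero_gen => g [->|].
  by split=> [||j|j]; rewrite expr2 !evM !ev_varX !(mulr0, mul0r, addr0).
have evY0 : forall h : P, idealY h -> ev0 h = 0 /\ evX h = 0.
  move=> h [s Ys ->]; split; rewrite raddf_sum /= big_seq big1 // => q /Ys[j ->].
    by rewrite !evM !ev_varY mulr0.
  by rewrite !evM !ev_varY !mulr0 addr0.
apply: ev_zero_gen => _ [u [v [/evY0[u0 uX] /evY0[v0 vX] ->]]].
by split=> [||j|j]; rewrite !evM !(u0, uX, v0, vX) !(mulr0, mul0r, addr0).
Qed.

Lemma relS_xx : xS * xS = 0.
Proof.
rewrite -rmorphM; apply/piS_eq0/ideal_gen_sub; left; exact: expr2.
Qed.

Lemma relS_yy j l : yS j * yS l = 0.
Proof.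
rewrite -rmorphM; apply/piS_eq0/ideal_gen_sub; right; apply: ideal_gen_sub.
by exists (varY k j), (varY k l); split=> //; apply: ideal_gen_sub; eexists.
Qed.

(** The coefficients of a class are read off a chosen representative; [coord_pi] shows that the
    choice is immaterial, since they vanish on the relations. *)
Definition c0 (s : R) : k := ev0 (repr s).
Definition cX (s : R) : k := evX (repr s).
Definition cY j (s : R) : k := evY j (repr s).
Definition cXY j (s : R) : k := evXY j (repr s).

Lemma coord_pi p : ((c0 (piS p) = ev0 p) * (cX (piS p) = evX p))
  * ((forall j, cY j (piS p) = evY j p) * (forall j, cXY j (piS p) = evXY j p)).
Proof.
have [e0 eX eY eXY] : ev_zero (repr (piS p) - p).
  by apply/ev_rel/piS_eq0; rewrite raddfB /= [piS (repr _)]reprK subrr.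
by (do 2!split) => [||j|j]; apply/eqP; rewrite -subr_eq0 -raddfB /= ?(e0, eX, eY, eXY).
Qed.

Fact c0_additive : zmod_morphism c0.
Proof.
move=> s t; case: (piS_surj s) (piS_surj t) => p <- [q <-].
by rewrite -raddfB /= !coord_pi raddfB.
Qed.
Fact cX_additive : zmod_morphism cX.
Proof.
move=> s t; case: (piS_surj s) (piS_surj t) => p <- [q <-].
by rewrite -raddfB /= !coord_pi raddfB.
Qed.
Fact cY_additive j : zmod_morphism (cY j).
Proof.
move=> s t; case: (piS_surj s) (piS_surj t) => p <- [q <-].
by rewrite -raddfB /= !coord_pi raddfB.
Qed.
Fact cXY_additive j : zmod_morphism (cXY j).
Proof.
move=> s t; case: (piS_surj s) (piS_surj t) => p <- [q <-].
by rewrite -raddfB /= !coord_pi raddfB.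
Qed.

HB.instance Definition _ := GRing.isZmodMorphism.Build R k c0 c0_additive.
HB.instance Definition _ := GRing.isZmodMorphism.Build R k cX cX_additive.
HB.instance Definition _ j := GRing.isZmodMorphism.Build R k (cY j) (cY_additive j).
HB.instance Definition _ j := GRing.isZmodMorphism.Build R k (cXY j) (cXY_additive j).

Lemma coordM s t : ((c0 (s * t) = c0 s * c0 t) * (cX (s * t) = c0 s * cX t + cX s * c0 t))
  * ((forall j, cY j (s * t) = c0 s * cY j t + cY j s * c0 t)
  * (forall j, cXY j (s * t) =
      c0 s * cXY j t + cX s * cY j t + cY j s * cX t + cXY j s * c0 t)).
Proof.
case: (piS_surj s) (piS_surj t) => p <- [q <-].
by (do 2!split) => [||j|j]; rewrite -rmorphM /= !coord_pi !evM.
Qed.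

Lemma coord_x : ((c0 xS = 0) * (cX xS = 1)) *
  ((forall j, cY j xS = 0) * (forall j, cXY j xS = 0)).
Proof. by (do 2!split) => [||j|j]; rewrite coord_pi ev_varX. Qed.

Lemma coord_y l : ((c0 (yS l) = 0) * (cX (yS l) = 0)) *
  ((forall j, cY j (yS l) = (j == l)%:R) * (forall j, cXY j (yS l) = 0)).
Proof. by (do 2!split) => [||j|j]; rewrite coord_pi ev_varY. Qed.

Lemma coord_C a : ((c0 (piC a) = a) * (cX (piC a) = 0)) *
  ((forall j, cY j (piC a) = 0) * (forall j, cXY j (piC a) = 0)).
Proof. by (do 2!split) => [||j|j]; rewrite coord_pi ev_C. Qed.


Lemma coordD s t : ((c0 (s + t) = c0 s + c0 t) * (cX (s + t) = cX s + cX t))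
  * ((forall j, cY j (s + t) = cY j s + cY j t)
  * (forall j, cXY j (s + t) = cXY j s + cXY j t)).
Proof. by (do 2!split) => [||j|j]; rewrite raddfD. Qed.

(* Sealed: rewriting with additivity lemmas would otherwise unfold it to a sum. *)
Definition mkQ (a : k) (b : 'I_i -> k) : R := locked (piC a + \sum_j piC (b j) * yS j).

Lemma mkQE a b : mkQ a b = piC a + \sum_j piC (b j) * yS j.
Proof. by rewrite /mkQ -lock. Qed.

Lemma coord_Q a b : ((c0 (mkQ a b) = a) * (cX (mkQ a b) = 0)) *
  ((forall j, cY j (mkQ a b) = b j) * (forall j, cXY j (mkQ a b) = 0)).
Proof.
(do 2!split) => [||j|j]; rewrite !mkQE raddfD raddf_sum /= coord_C.
- by rewrite big1 ?addr0 // => l _; rewrite coordM coord_y mulr0.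
- by rewrite add0r big1 // => l _; rewrite coordM !coord_C !coord_y !(mulr0, mul0r, addr0).
- rewrite add0r (bigD1 j) //= coordM !coord_C !coord_y eqxx mul0r mulr1 addr0.
  rewrite big1 ?addr0 // => l /negPf nlj.
  by rewrite coordM !coord_C !coord_y [j == l]eq_sym nlj !(mulr0, mul0r, addr0).
- by rewrite add0r big1 // => l _; rewrite !coordM !coord_C !coord_y !(mulr0, mul0r, addr0).
Qed.

Lemma mkQD a b a' b' : mkQ a b + mkQ a' b' = mkQ (a + a') (fun j => b j + b' j).
Proof.
rewrite !mkQE rmorphD addrACA -big_split /=; congr (_ + _).
by apply: eq_bigr => j _; rewrite rmorphD mulrDl.
Qed.

Lemma mkQM a b a' b' :
  mkQ a b * mkQ a' b' = mkQ (a * a') (fun j => a * b' j + b j * a').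
Proof.
have yy0 : (\sum_j piC (b j) * yS j) * (\sum_j piC (b' j) * yS j) = 0.
  rewrite mulr_suml big1 // => j _; rewrite mulr_sumr big1 // => l _.
  by rewrite mulrACA relS_yy mulr0.
rewrite !mkQE mulrDl !mulrDr yy0 addr0 -addrA rmorphM; congr (_ + _).
rewrite mulr_suml mulr_sumr -big_split /=; apply: eq_bigr => j _.
rewrite rmorphD !rmorphM; ring.
Qed.

(** This is Q + xQ. It is closed under sums and products and contains the constants and the
    variables, hence is the whole ring. *)
Let span s := exists a b c d, s = mkQ a b + xS * mkQ c d.

Let span_add s t : span s -> span t -> span (s + t).
Proof.
move=> [a [b [c [d ->]]]] [a' [b' [c' [d' ->]]]].
rewrite addrACA mkQD -mulrDr mkQD; by do 4!eexists.
Qed.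

Let span_mul s t : span s -> span t -> span (s * t).
Proof.
move=> [a [b [c [d ->]]]] [a' [b' [c' [d' ->]]]].
have -> : forall u v u' v' : R, (u + xS * v) * (u' + xS * v')
    = u * u' + xS * (u * v' + v * u') + xS * xS * (v * v') by move=> *; ring.
rewrite relS_xx mul0r addr0 !mkQM mkQD; by do 4!eexists.
Qed.

Let span_Q a b : span (mkQ a b).
Proof.
exists a, b, 0, (fun=> 0); rewrite [mkQ 0 _]mkQE rmorph0 add0r big1 ?mulr0 ?addr0 // => j _.
by rewrite mul0r.
Qed.

Let span_C a : span (piC a).
Proof.
have -> : piC a = mkQ a (fun=> 0); last exact: span_Q.
by rewrite !mkQE rmorph0 big1 ?addr0 // => j _; rewrite mul0r.
Qed.

Let spanS s : span s.
Proof.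
have [p <-] := piS_surj s; elim/mpolyind: p => [|a m p _ _].
  by rewrite rmorph0 -(rmorph0 piC).
rewrite rmorphD -mul_mpolyC rmorphM; apply/span_add/span_mul; first exact: span_C.
rewrite mpolyXE_id rmorph_prod; apply: (big_ind span) => [||l _].
- by rewrite -(rmorph1 piC).
- exact: span_mul.
rewrite rmorphXn; elim: (m l) => [|e IHe]; first by rewrite expr0 -(rmorph1 piC).
rewrite exprS; apply: span_mul IHe; case: (unliftP ord0 l) => [j ->|->].
  change (span (yS j)); have -> : yS j = mkQ 0 (fun l => (l == j)%:R); last exact: span_Q.
  rewrite !mkQE rmorph0 add0r (bigD1 j) //= eqxx rmorph1 mul1r big1 ?addr0 // => l' /negPf->.
  by rewrite rmorph0 mul0r.
change (span xS); exists 0, (fun=> 0), 1, (fun=> 0); rewrite !mkQE rmorph0 rmorph1 big1 => [|j _].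
  by rewrite !addr0 add0r mulr1.
by rewrite mul0r.
Qed.

Let coord_Qx a b c d (s := mkQ a b + xS * mkQ c d) :
  [/\ c0 s = a, cX s = c, cY^~ s = b & cXY^~ s = d].
Proof.
split; [| |apply/funext => j|apply/funext => j]; rewrite /s raddfD /= coordM !coord_Q !coord_x;
  by rewrite !(mulr0, mul0r, addr0, add0r, mul1r).
Qed.

Lemma S_decomp s :
  s = mkQ (c0 s) (cY^~ s) + xS * mkQ (cX s) (cXY^~ s).
Proof.
by have [a [b [c [d ->]]]] := spanS s; have [-> -> -> ->] := coord_Qx a b c d.
Qed.

Lemma coord_ext s t : c0 s = c0 t -> cX s = cX t -> (forall j, cY j s = cY j t) ->
  (forall j, cXY j s = cXY j t) -> s = t.
Proof.
move=> e0 eX eY eXY; rewrite (S_decomp s) (S_decomp t) e0 eX.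
by congr (mkQ _ _ + _ * mkQ _ _); apply/funext.
Qed.

(** The components along R = Q + xQ: [q0] is the ring retraction onto Q that kills x, and [q1] is a
    derivation over it. The equation [q1 s = 0] encodes that s lies in Q. *)
Definition q0 (s : R) : R := mkQ (c0 s) (cY^~ s).
Definition q1 (s : R) : R := mkQ (cX s) (cXY^~ s).

Lemma q01E s : s = q0 s + xS * q1 s. Proof. exact: S_decomp. Qed.

Fact q0_additive : zmod_morphism q0.
Proof.
move=> s t; apply: coord_ext => [||j|j];
  by rewrite raddfB /= !coord_Q ?raddfB //= ?subr0.
Qed.

Fact q1_additive : zmod_morphism q1.
Proof.
move=> s t; apply: coord_ext => [||j|j];
  by rewrite raddfB /= !coord_Q ?raddfB //= ?subr0.
Qed.

HB.instance Definition _ := GRing.isZmodMorphism.Build R R q0 q0_additive.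
HB.instance Definition _ := GRing.isZmodMorphism.Build R R q1 q1_additive.

Lemma q0M s t : q0 (s * t) = q0 s * q0 t.
Proof.
by apply: coord_ext => [||j|j]; rewrite !coordM !coord_Q ?coordM //
  !(mulr0, mul0r, addr0).
Qed.

Lemma q1M s t : q1 (s * t) = q0 s * q1 t + q1 s * q0 t.
Proof.
apply: coord_ext => [||j|j]; rewrite coordD !coordM !coord_Q ?coordM //; ring.
Qed.

Lemma q0x : q0 xS = 0.
Proof.
by apply: coord_ext => [||j|j]; rewrite coord_Q ?coord_x raddf0.
Qed.
Lemma q1x : q1 xS = 1.
Proof.
apply: coord_ext => [||j|j]; rewrite coord_Q ?coord_x -(rmorph1 piC) coord_C //.
Qed.

End Coordinates.

(** * Modules over a commutative ring *)

Section Modules.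
Variable R : comNzRingType.
Implicit Types M N : lmodType R.

Lemma linear_ex M N (f : M -> N) : linear f -> exists g : {linear M -> N}, g =1 f.
Proof.
move=> lf; pose L := GRing.isLinear.Build R M N _ f lf.
by exists (HB.pack f L : {linear M -> N}).
Qed.

Lemma cV_basis n (v : 'cV[R]_n) : v = \sum_j v j 0 *: delta_mx j 0.
Proof.
rewrite [LHS]matrix_sum_delta; apply: eq_bigr => j _.
by rewrite big_ord1.
Qed.

Lemma cV_linear_ex M n (m : 'I_n -> M) :
  exists f : {linear 'cV[R]_n -> M}, forall v, f v = \sum_j v j 0 *: m j.
Proof.
apply: linear_ex => a u v; rewrite scaler_sumr -big_split /=.
by apply: eq_bigr => j _; rewrite !mxE scalerDl scalerA.
Qed.

Lemma cV_linearE M n (f : {linear 'cV[R]_n -> M}) v :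
  f v = \sum_j v j 0 *: f (delta_mx j 0).
Proof. by rewrite {1}[v]cV_basis linear_sum; apply: eq_bigr => j _; rewrite linearZ. Qed.

Lemma cV_projective n : projective 'cV[R]_n.
Proof.
move=> A B g f gsurj.
have [a ga] : exists a : 'I_n -> A, forall j, g (a j) = f (delta_mx j 0).
  by have [a ga] := choice (fun j => gsurj (f (delta_mx j 0))); exists a.
have [h hE] := cV_linear_ex a; exists h => v.
rewrite hE linear_sum [RHS]cV_linearE; apply: eq_bigr => j _.
by rewrite linearZ /= ga.
Qed.

Lemma cV_functional n (f : {linear 'cV[R]_n -> R^o}) :
  exists r : 'rV[R]_n, forall v, f v = (r *m v) 0 0.
Proof.
exists (\row_j f (delta_mx j 0)) => v; rewrite cV_linearE mxE.
by apply: eq_bigr => j _; rewrite mxE mulrC.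
Qed.

Lemma cV_matrix n m (f : {linear 'cV[R]_n -> 'cV[R]_m}) :
  exists F : 'M[R]_(m, n), forall v, f v = F *m v.
Proof.
exists (\matrix_(a, b) f (delta_mx b 0) a 0) => v.
rewrite cV_linearE; apply/matrixP => a b; rewrite ord1 summxE mxE.
by apply: eq_bigr => j _; rewrite !mxE mulrC.
Qed.

Lemma linear_inverse M N (f : {linear M -> N}) : bijective f ->
  exists2 g : {linear N -> M}, cancel f g & cancel g f.
Proof.
case=> g fK gK.
have lg : linear g.
  by move=> a u v; rewrite -[a *: g u + g v]fK linearP !gK.
by have [h hE] := linear_ex lg; exists h => x; rewrite hE ?fK ?gK.
Qed.

Lemma lmod_iso_sym M N : lmod_iso M N -> lmod_iso N M.
Proof. by case=> f /linear_inverse[g fK gK]; exists g; exists f. Qed.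

Lemma lmod_iso_refl M : lmod_iso M M.
Proof. by exists idfun; exists idfun. Qed.

Lemma lmod_iso_trans M N P : lmod_iso M N -> lmod_iso N P -> lmod_iso M P.
Proof.
case=> f bf [g bg]; exists (g \o f : {linear M -> P}); exact: bij_comp.
Qed.

(** A set-theoretic section of [f] is enough: followed by [g] it becomes linear, because [g] kills
    the kernel of [f]. *)
Lemma linear_factor (G : lmodType R) M N (f : {linear G -> M}) (g : {linear G -> N}) :
  (forall y, exists x, f x = y) -> (forall x, f x = 0 -> g x = 0) ->
  exists h : {linear M -> N}, forall x, h (f x) = g x.
Proof.
move=> fsurj fg; have [s sK] := choice fsurj.
have gs x : g (s (f x)) = g x.
  by apply/eqP; rewrite -subr_eq0 -linearB /= fg // linearB /= sK subrr.
have lgs : linear (g \o s).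
  move=> a u v /=; rewrite -{1}(sK u) -{1}(sK v) -linearP /=.
  by rewrite gs linearP.
by have [h hE] := linear_ex lgs; exists h => x; rewrite hE /= gs.
Qed.

Lemma lmod_iso_ker (G : lmodType R) M N (f : {linear G -> M}) (g : {linear G -> N}) :
  (forall y, exists x, f x = y) -> (forall y, exists x, g x = y) ->
  (forall x, f x = 0 <-> g x = 0) -> lmod_iso M N.
Proof.
move=> fs gs fg.
have [h hE] := linear_factor fs (fun x => proj1 (fg x)).
have [h' hE'] := linear_factor gs (fun x => proj2 (fg x)).
exists h; exists h' => x.
  by have [y <-] := fs x; rewrite hE hE'.
by have [y <-] := gs x; rewrite hE' hE.
Qed.

(** Free modules being projective, the isomorphism and its inverse lift to matrices between the
    covers. *)
Lemma lmod_iso_cover M N n m (f : {linear 'cV[R]_n -> M}) (g : {linear 'cV[R]_m -> N}) :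
  (forall y, exists x, f x = y) -> (forall y, exists x, g x = y) -> lmod_iso M N ->
  exists (G : 'M[R]_(m, n)) (G' : 'M[R]_(n, m)),
    (forall v, f v = 0 -> g (G *m v) = 0) /\ (forall v, f (G' *m (G *m v)) = f v).
Proof.
move=> fs gs [h /linear_inverse[h' hK h'K]].
have [u uE] := cV_projective (h \o f : {linear _ -> _}) gs.
have [u' uE'] := cV_projective (h' \o g : {linear _ -> _}) fs.
have [G GE] := cV_matrix u; have [G' GE'] := cV_matrix u'.
exists G, G'; split=> v; first by rewrite -GE uE /= => ->; rewrite linear0.
by rewrite -GE -GE' uE' /= uE /= hK.
Qed.

Lemma generated_by_surj M N n (f : {linear M -> N}) :
  (forall y, exists x, f x = y) -> generated_by M n -> generated_by N n.
Proof.
move=> fs [g gen]; exists (f \o g) => y; have [x <-] := fs y.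
have [c ->] := gen x; exists c; rewrite linear_sum; apply: eq_bigr => j _.
by rewrite linearZ.
Qed.

Lemma generated_by_iso M N n : lmod_iso M N -> generated_by M n -> generated_by N n.
Proof.
by case=> f [g fK gK]; apply: (@generated_by_surj _ _ _ f) => y; exists (g y).
Qed.

Lemma min_generated_uniq M N n m : lmod_iso M N ->
  min_generated_by M n -> min_generated_by N m -> n = m.
Proof.
move=> MN [Mn nmin] [Nm mmin]; apply/eqP; rewrite eqn_leq nmin ?mmin //.
  exact: generated_by_iso Mn.
by apply: generated_by_iso Nm; exact: lmod_iso_sym.
Qed.

Lemma regular_projective : projective R^o.
Proof.
move=> A B g f gs; have [a ga] := gs (f 1).
have la : linear (fun r : R^o => r *: a) by move=> c u v; rewrite scalerDl scalerA.
have [h hE] := linear_ex la; exists h => r.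
by rewrite hE linearZ /= ga -linearZ /= -[r *: 1]/(r * 1) mulr1.
Qed.

End Modules.

(** * Submodules cut out by a predicate *)

Section Submodule.
Variables (R : comNzRingType) (M : lmodType R) (S : M -> Prop).
Hypothesis S0 : S 0.
Hypothesis SP : forall a u v, S u -> S v -> S (a *: u + v).

(** The closure proofs are arguments of the predicate, so that the submodule structure can be
    declared on it for every such [S]. *)
Definition subm_pred of S 0 & (forall a u v, S u -> S v -> S (a *: u + v)) : {pred M} :=
  fun x => `[< S x >].

Fact subm_closed : submod_closed (subm_pred S0 SP).
Proof.
by split=> [|a u v /asboolP Su /asboolP Sv]; apply/asboolP; [exact: S0|exact: SP].
Qed.

HB.instance Definition _ :=
  GRing.isSubmodClosed.Build R M (subm_pred S0 SP) subm_closed.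

Record subm := Subm { subm_val : M; subm_valP : subm_val \in subm_pred S0 SP }.

HB.instance Definition _ := [isSub for subm_val].
HB.instance Definition _ := [Choice of subm by <:].
HB.instance Definition _ := [SubChoice_isSubLmodule of subm by <:].

Lemma submP (w : subm) : S (subm_val w).
Proof. exact/asboolP/subm_valP. Qed.

Lemma subm_linear : linear subm_val. Proof. by []. Qed.

Lemma subm_inj : injective subm_val. Proof. exact: val_inj. Qed.

Lemma subm_eq0 w : w = 0 <-> subm_val w = 0.
Proof. by split=> [->|w0] //; apply: subm_inj. Qed.

Lemma subm_lift (G : lmodType R) (f : {linear G -> M}) : (forall x, S (f x)) ->
  exists g : {linear G -> subm}, forall x, subm_val (g x) = f x.
Proof.
move=> Sf; have Sf' x : f x \in subm_pred S0 SP by exact/asboolP.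
have lg : linear (fun x => Subm (Sf' x)).
  by move=> a u v; apply: subm_inj; rewrite subm_linear /= linearP.
by have [g gE] := linear_ex lg; exists g => x; rewrite gE.
Qed.

End Submodule.

(** If [f x0 = 1], then x = f(x) x0 + (x - f(x) x0) splits M into R and the kernel of [f], and R is
    projective and nonzero. *)
Lemma no_summand_functional (R : comNzRingType) (M : lmodType R) (f : {linear M -> R^o}) x0 :
  no_proj_summand M -> f x0 <> 1.
Proof.
move=> nps f1.
have S0 : f 0 = 0 by rewrite linear0.
have SP a u v : f u = 0 -> f v = 0 -> f (a *: u + v) = 0.
  by move=> fu fv; rewrite linearP fu fv /= scaler0 addr0.
pose K := subm S0 SP.
have pS x : f (x - f x *: x0) = 0.
  by rewrite linearB linearZ /= f1 -[_ *: _]/(f x * 1) mulr1 subrr.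
have lp : linear (fun x => x - f x *: x0).
  by move=> a u v; rewrite linearP /= scalerDl -scalerA scalerBr opprD addrACA.
have [p pE] := linear_ex lp.
have [q qE] := @subm_lift _ _ _ S0 SP M p (fun x => etrans (congr1 f (pE x)) (pS x)).
have lh : linear (fun x => (f x, q x) : (R^o * K)%type).
  by move=> a u v; rewrite !linearP.
have [h hE] := linear_ex lh.
have bh : bijective h.
  exists (fun z => z.1 *: x0 + subm_val z.2) => [x|[r w]].
    by rewrite hE /= qE pE addrC subrK.
  have fw : f (r *: x0 + subm_val w) = r.
    by rewrite linearP /= f1 (submP w) addr0 -[_ *: _]/(r * 1) mulr1.
  rewrite hE fw; congr (_, _); apply: subm_inj.
  by rewrite qE pE fw addrC addKr.
have /eqP := nps R^o K (ex_intro _ h bh) (@regular_projective R) 1.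
by rewrite oner_eq0.
Qed.

(** * The exact pair x + N, x - N *)

Section Matrices.
Variables (k : fieldType) (i : nat).
Local Notation R := (ringS k i).
Local Notation xS := (xS k i).
Local Notation yS := (@yS k i).
Local Notation piC := (@piC k i).

Fact c0_monoid : monoid_morphism (@c0 k i).
Proof. by split=> [|s t]; rewrite -?(rmorph1 piC) ?coordM ?coord_C. Qed.
HB.instance Definition _ := GRing.isMonoidMorphism.Build R k (@c0 k i) c0_monoid.

Fact q0_monoid : monoid_morphism (@q0 k i).
Proof.
split=> [|s t]; last exact: q0M.
by apply: coord_ext => [||j|j]; rewrite coord_Q -(rmorph1 piC) ?coord_C.
Qed.
HB.instance Definition _ := GRing.isMonoidMorphism.Build R R (@q0 k i) q0_monoid.

Lemma q0_C a : q0 (piC a) = piC a.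
Proof. by apply: coord_ext => [||j|j]; rewrite coord_Q ?coord_C. Qed.
Lemma q1_C a : q1 (piC a) = 0.
Proof. by apply: coord_ext => [||j|j]; rewrite coord_Q ?coord_C raddf0. Qed.
Lemma q0_y j : q0 (yS j) = yS j.
Proof. by apply: coord_ext => [||l|l]; rewrite coord_Q ?coord_y. Qed.
Lemma q1_y j : q1 (yS j) = 0.
Proof. by apply: coord_ext => [||l|l]; rewrite coord_Q ?coord_y raddf0. Qed.

Lemma map_q1M m n p (A : 'M[R]_(m, n)) (B : 'M_(n, p)) :
  map_mx (@q1 k i) (A *m B) = map_mx (@q0 k i) A *m map_mx (@q1 k i) B
    + map_mx (@q1 k i) A *m map_mx (@q0 k i) B.
Proof.
apply/matrixP => a b; rewrite !mxE raddf_sum -big_split /=.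
by apply: eq_bigr => j _; rewrite q1M !mxE.
Qed.

Lemma map_cXM m n p (A : 'M[R]_(m, n)) (B : 'M_(n, p)) :
  map_mx (@cX k i) (A *m B) = map_mx (@c0 k i) A *m map_mx (@cX k i) B
    + map_mx (@cX k i) A *m map_mx (@c0 k i) B.
Proof.
apply/matrixP => a b; rewrite !mxE raddf_sum -big_split /=.
by apply: eq_bigr => j _; rewrite coordM !mxE.
Qed.

Lemma map_cXYM l m n p (A : 'M[R]_(m, n)) (B : 'M_(n, p)) :
  map_mx (cXY l) (A *m B) = map_mx (@c0 k i) A *m map_mx (cXY l) B
    + map_mx (@cX k i) A *m map_mx (cY l) B
    + map_mx (cY l) A *m map_mx (@cX k i) B
    + map_mx (cXY l) A *m map_mx (@c0 k i) B.
Proof.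
apply/matrixP => a b; rewrite !mxE raddf_sum -!big_split /=.
by apply: eq_bigr => j _; rewrite coordM !mxE.
Qed.

Lemma map_cYM l m n p (A : 'M[R]_(m, n)) (B : 'M_(n, p)) :
  map_mx (cY l) (A *m B) = map_mx (@c0 k i) A *m map_mx (cY l) B
    + map_mx (cY l) A *m map_mx (@c0 k i) B.
Proof.
apply/matrixP => a b; rewrite !mxE raddf_sum -big_split /=.
by apply: eq_bigr => j _; rewrite coordM !mxE.
Qed.

Lemma mx_q01E m n (A : 'M[R]_(m, n)) :
  A = map_mx (@q0 k i) A + xS *: map_mx (@q1 k i) A.
Proof. by apply/matrixP => a b; rewrite !mxE -q01E. Qed.

Lemma map_scalar (S T : nzRingType) (f : {additive S -> T}) n (a : S) :
  map_mx f (a%:M : 'M_n) = (f a)%:M.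
Proof. by apply/matrixP => r c; rewrite !mxE raddfMn. Qed.

Section Phi.
Variable n : nat.
Implicit Types A B : {ffun 'I_i -> 'M[k]_n}.

Definition Nmx A : 'M[R]_n := \sum_j yS j *: map_mx piC (A j).
Definition Phi A : 'M[R]_n := locked (xS%:M + Nmx A).
Lemma PhiE A : Phi A = xS%:M + Nmx A. Proof. by rewrite /Phi -lock. Qed.
Definition trA A : {ffun 'I_i -> 'M[k]_n} := [ffun j => (A j)^T].

Lemma NmxN A : Nmx (- A) = - Nmx A.
Proof.
rewrite /Nmx -sumrN; apply: eq_bigr => j _.
by rewrite ffunE map_mxN scalerN.
Qed.

Lemma NmxM A B : Nmx A *m Nmx B = 0.
Proof.
rewrite /Nmx mulmx_suml big1 // => j _; rewrite mulmx_sumr big1 // => l _.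
by rewrite -scalemxAl -scalemxAr scalerA relS_yy scale0r.
Qed.

Lemma Phi_tr A : (Phi A)^T = Phi (trA A).
Proof.
rewrite !PhiE linearD /= tr_scalar_mx /Nmx linear_sum /=; congr (_ + _).
by apply: eq_bigr => j _; rewrite linearZ /= ffunE map_trmx.
Qed.

Lemma trAN A : trA (- A) = - trA A.
Proof. by apply/ffunP => j; rewrite !ffunE linearN. Qed.

Lemma PhiM0 A : Phi (- A) *m Phi A = 0.
Proof.
rewrite !PhiE NmxN mulmxDl !mulmxDr !mulNmx NmxM oppr0 addr0.
by rewrite -scalar_mxM relS_xx raddf0 add0r scalar_mxC subrr.
Qed.

Lemma PhiNM0 A : Phi A *m Phi (- A) = 0.
Proof. by rewrite -{1}(opprK A) PhiM0. Qed.

Lemma q0_Nmx A : map_mx (@q0 k i) (Nmx A) = Nmx A.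
Proof.
rewrite /Nmx raddf_sum; apply: eq_bigr => j _; apply/matrixP => a b.
by rewrite !mxE /= q0M q0_y q0_C.
Qed.
Lemma q1_Nmx A : map_mx (@q1 k i) (Nmx A) = 0.
Proof.
rewrite /Nmx raddf_sum big1 // => j _; apply/matrixP => a b.
by rewrite !mxE /= q1M q1_y q1_C mul0r mulr0 addr0.
Qed.
Lemma q0_Phi A : map_mx (@q0 k i) (Phi A) = Nmx A.
Proof. by rewrite !PhiE raddfD /= q0_Nmx map_scalar /= q0x raddf0 add0r. Qed.
Lemma q1_Phi A : map_mx (@q1 k i) (Phi A) = 1%:M.
Proof. by rewrite !PhiE raddfD /= q1_Nmx map_scalar /= q1x addr0. Qed.

(** The [q1]-part of (x + N) v = 0 reads [q0 v] = - N [q1 v], so v = [q0 v] + x [q1 v] = (x - N)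
    [q1 v]. *)
Lemma Phi_ker A m (v : 'M[R]_(n, m)) : Phi A *m v = 0 ->
  v = Phi (- A) *m map_mx (@q1 k i) v.
Proof.
move=> /(congr1 (map_mx (@q1 k i))).
rewrite map_q1M q0_Phi q1_Phi mul1mx raddf0 addrC => /eqP; rewrite addr_eq0 => /eqP q0v.
by rewrite [LHS]mx_q01E q0v PhiE NmxN mulmxDl mul_scalar_mx mulNmx addrC.
Qed.

(** The transpose of [Phi_ker]; it keeps the resolution exact after dualizing into R. *)
Lemma Phi_coker A m (v : 'M[R]_(m, n)) : v *m Phi A = 0 ->
  exists w, v = w *m Phi (- A).
Proof.
move=> /(congr1 trmx); rewrite trmx_mul Phi_tr trmx0 => /Phi_ker E.
exists (map_mx (@q1 k i) v^T)^T; apply: trmx_inj.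
by rewrite trmx_mul trmxK Phi_tr trAN.
Qed.

Lemma c0_Phi A : map_mx (@c0 k i) (Phi A) = 0.
Proof.
rewrite !PhiE raddfD /= map_scalar /= coord_x raddf0 add0r /Nmx raddf_sum big1 // => j _.
by apply/matrixP => a b; rewrite !mxE /= coordM coord_y mul0r.
Qed.
Lemma cX_Phi A : map_mx (@cX k i) (Phi A) = 1%:M.
Proof.
rewrite !PhiE raddfD /= map_scalar /= coord_x /Nmx raddf_sum big1 ?addr0 // => j _.
by apply/matrixP => a b; rewrite !mxE /= coordM !coord_y coord_C mul0r mul0r addr0.
Qed.
Lemma cY_Phi A l : map_mx (cY l) (Phi A) = A l.
Proof.
rewrite !PhiE raddfD /= map_scalar /= coord_x raddf0 add0r /Nmx raddf_sum (bigD1 l) //=.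
rewrite big1 ?addr0 => [|j /negPf nj]; apply/matrixP => a b;
  rewrite !mxE /= coordM !coord_y !coord_C ?eqxx ?[l == j]eq_sym ?nj.
  by rewrite mul0r add0r mul1r.
by rewrite !mul0r addr0.
Qed.
End Phi.
End Matrices.

(** * The totally reflexive module of a tuple of matrices *)

Section ModuleOfMatrices.
Variables (k : fieldType) (i n : nat).
Local Notation R := (ringS k i).
Implicit Types A B : {ffun 'I_i -> 'M[k]_n}.

Fact MA0 A : Phi (- A) *m (0 : 'cV[R]_n) = 0. Proof. exact: mulmx0. Qed.
Fact MAP A (a : R) (u v : 'cV[R]_n) : Phi (- A) *m u = 0 -> Phi (- A) *m v = 0 ->
  Phi (- A) *m (a *: u + v) = 0.
Proof. by move=> u0 v0; rewrite mulmxDr -scalemxAr u0 v0 scaler0 addr0. Qed.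

(** Taken as ker (x - N) inside R^n, so that its functionals become row vectors; [MA_cover] shows
    that it is also the image of x + N. *)
Definition MA A : lmodType R := subm (MA0 A) (@MAP A).

Lemma MA_cover A : exists2 g : {linear 'cV[R]_n -> MA A},
  (forall v, subm_val (g v) = Phi A *m v) &
  (forall w, exists v, g v = w) /\ (forall v, g v = 0 <-> Phi A *m v = 0).
Proof.
have PA v : Phi (- A) *m (Phi A *m v : 'cV[R]_n) = 0 by rewrite mulmxA PhiM0 mul0mx.
have [g gE] := @subm_lift _ _ _ (MA0 A) (@MAP A) _ (mulmx (Phi A)) PA.
exists g; first exact: gE.
split=> [w|v]; last by rewrite -gE; exact: subm_eq0.
have /Phi_ker E := submP w; rewrite opprK in E.
by exists (map_mx (@q1 k i) (subm_val w)); apply: subm_inj; rewrite gE [RHS]E.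
Qed.

Lemma mulmx_deltaP m (r : 'rV[R]_m) :
  (forall v : 'cV[R]_m, (r *m v) 0 0 = 0) -> r = 0.
Proof.
move=> r0; apply/rowP => j; move: (r0 (delta_mx j 0)).
by rewrite -colE !mxE.
Qed.

Lemma mulmx_delta_ext m p (A B : 'M[R]_(m, p)) :
  (forall j, A *m (delta_mx j 0 : 'cV_p) = B *m delta_mx j 0) -> A = B.
Proof.
move=> AB; apply/matrixP => a j; move/matrixP/(_ a 0): (AB j).
by rewrite -!colE !mxE.
Qed.

Section Cover.
Variables (M : lmodType R) (A : {ffun 'I_i -> 'M[k]_n}) (g : {linear 'cV[R]_n -> M}).
Hypothesis g_surj : forall x, exists v, g v = x.
Hypothesis g_ker : forall v, g v = 0 <-> Phi A *m v = 0.

(** The signs alternate along the resolution, starting with - A because ker [g] = ker (x + N) = im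
    (x - N). *)
Let sg j := if odd j then A else - A.
Let sgS j : sg j.+1 = - sg j. Proof. by rewrite /sg /=; case: odd; rewrite ?opprK. Qed.

Let d j : {linear 'cV[R]_n -> 'cV[R]_n} := mulmx (Phi (sg j)).

Let exact_Phi B (y : 'cV[R]_n) :
  Phi B *m y = 0 <-> exists z : 'cV[R]_n, Phi (- B) *m z = y.
Proof.
split=> [/Phi_ker E|[z <-]]; last by rewrite mulmxA PhiNM0 mul0mx.
by exists (map_mx (@q1 k i) y).
Qed.

Let exact0 y : g y = 0 <-> exists z, d 0 z = y.
Proof. by rewrite g_ker exact_Phi. Qed.

Let exactS j y : d j y = 0 <-> exists z, d j.+1 z = y.
Proof. by rewrite /d sgS; exact: exact_Phi. Qed.

Definition Phi_resolution : proj_resolution M :=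
  @ProjResolution R M (fun=> 'cV[R]_n) d g (fun=> @cV_projective R n) g_surj exact0 exactS.

(** A cocycle is a row killed by one differential, hence by [Phi_coker] a multiple of the previous
    one. Only the cover of M matters, so this serves both [MA A] and its dual. *)
Lemma Ext_Phi j : (0 < j)%N -> Ext_eq0 j M R^o.
Proof.
case: j => // j _; exists Phi_resolution => f fc.
have [r fE] := cV_functional f.
have /Phi_coker[w rE] : r *m Phi (sg j.+1) = 0.
  apply: mulmx_deltaP => v; rewrite -mulmxA -fE; exact: fc.
have lw : linear (fun v : 'cV[R]_n => (w *m v) 0 0 : R^o).
  by move=> a u v; rewrite mulmxDr -scalemxAr !mxE.
have [h hE] := linear_ex lw; exists h => x.
by rewrite fE hE rE sgS opprK mulmxA.
Qed.

End Cover.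

(** A functional pulled back to R^n is a row killed by x - N, hence of the form w (x + N), which is
    w acting on [MA A]. It vanishes iff w (x + N) = 0, whence the transposed tuple. *)
Lemma MA_dual_cover A : exists2 g : {linear 'cV[R]_n -> dual_mod (MA A)},
  (forall b w, g b w = (b^T *m subm_val w) 0 0) &
  (forall phi, exists b, g b = phi) /\
  (forall b, g b = 0 <-> Phi (trA A) *m b = 0).
Proof.
have lb (b : 'cV[R]_n) :
    (fun w : MA A => (b^T *m subm_val w) 0 0 : R^o) \in @is_linear R (MA A) R^o.
  by apply/asboolP => a u v; rewrite subm_linear mulmxDr -scalemxAr !mxE.
have lg : linear (fun b => LinHom (lb b) : dual_mod (MA A)).
  move=> a u v; apply: val_inj; apply/funext => w.
  rewrite -[RHS]/(a * (u^T *m subm_val w) 0 0 + (v^T *m subm_val w) 0 0) /=.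
  by rewrite [(_ + _)^T]linearP mulmxDl /= -scalemxAl !mxE.
have [g gE] := linear_ex lg; have [c cE [cs ck]] := MA_cover A.
have gbE b w : g b w = (b^T *m subm_val w) 0 0 by rewrite gE.
exists g; first exact: gbE.
split=> [phi|b].
  have /asboolP lphi := valP phi.
  have [p pE] := linear_ex lphi.
  have [r rE] := cV_functional (p \o c : {linear _ -> R^o}).
  have /Phi_coker[w wE] : r *m Phi (- A) = 0.
    apply: mulmx_deltaP => v; rewrite -mulmxA -rE /=.
    have -> : c (Phi (- A) *m v) = 0 by apply/ck; rewrite mulmxA PhiNM0 mul0mx.
    by rewrite linear0.
  exists w^T; apply: val_inj; apply/funext => x; have [v <-] := cs x.
  have -> : \val (g w^T) (c v) = g w^T (c v) by [].
  by rewrite gbE trmxK cE mulmxA -[A in Phi A]opprK -wE -rE /= pE.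
have -> : g b = 0 <-> forall v : 'cV[R]_n, (b^T *m Phi A *m v) 0 0 = 0.
  split=> [gb0 v|b0].
    by rewrite -mulmxA -cE -gbE gb0.
  apply: val_inj; apply/funext => x; have [v <-] := cs x.
  have -> : \val (g b) (c v) = g b (c v) by [].
  by rewrite gbE cE mulmxA b0.
split=> [/mulmx_deltaP b0|b0 v].
  by apply: trmx_inj; rewrite trmx_mul -Phi_tr trmxK b0 trmx0.
by rewrite -[X in X *m v]trmxK trmx_mul trmxK Phi_tr b0 trmx0 mul0mx mxE.
Qed.

Lemma inj_surj_bij (T U : Type) (f : T -> U) :
  injective f -> (forall y, exists x, f x = y) -> bijective f.
Proof.
move=> fi fs; have [s sK] := choice fs.
by exists s => // x; apply: fi; rewrite sK.
Qed.

(** The coordinates of R^n separate the points of [MA A]. A functional on the dual pulls back to a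
    row r whose transpose lies in ker (x - N), and it is evaluation at that element. *)
Lemma MA_biduality A : bijective (@biduality R (MA A)).
Proof.
have [g gE [gs gk]] := MA_dual_cover A.
apply: inj_surj_bij => [x y xy|F].
  apply: subm_inj; apply/matrixP => a b; rewrite ord1 {b}.
  have : biduality x (g (delta_mx a 0)) = biduality y (g (delta_mx a 0)) by rewrite xy.
  by rewrite /= !gE trmx_delta -!rowE !mxE.
have /asboolP lF := valP F; have [p pE] := linear_ex lF.
have [r rE] := cV_functional (p \o g : {linear _ -> R^o}).
have r0 : Phi (- A) *m r^T = 0.
  apply: trmx_inj; rewrite trmx_mul trmxK trmx0 Phi_tr trAN.
  apply: mulmx_deltaP => v; rewrite -mulmxA -rE /=.
  have -> : g (Phi (- trA A) *m v) = 0 by apply/gk; rewrite mulmxA PhiNM0 mul0mx.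
  by rewrite linear0.
have rP : r^T \in subm_pred (MA0 A) (@MAP A) by apply/asboolP.
exists (Subm rP); apply: val_inj; apply/funext => phi; have [b <-] := gs phi.
rewrite [LHS]/= gE /= -[b^T *m r^T]trmx_mul mxE -rE /=; exact: pE.
Qed.

Lemma MA_totally_reflexive A : totally_reflexive (MA A).
Proof.
have [c cE [cs ck]] := MA_cover A; have [g gE [gs gk]] := MA_dual_cover A.
split; last exact: MA_biduality.
- by exists n; exists (fun j => c (delta_mx j 0)) => w; have [v <-] := cs w;
    exists (fun j => v j 0); exact: cV_linearE.
- by move=> j j0; exact: Ext_Phi cs ck _ j0.
- by move=> j j0; exact: Ext_Phi gs gk _ j0.
Qed.

(* The x-coefficient maps MA A onto k^n, and is k-linear through c0 because
   c0 vanishes on MA A. *)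
Lemma MA_min_generated A : min_generated_by (MA A) n.
Proof.
have [c cE [cs ck]] := MA_cover A; split=> [|m [g gen]].
  by exists (fun j => c (delta_mx j 0)) => w; have [v <-] := cs w;
    exists (fun j => v j 0); exact: cV_linearE.
have {}gen w : exists v : 'cV[R]_m, w = \sum_j v j 0 *: g j.
  have [d ->] := gen w; exists (\col_j d j); by apply: eq_bigr => j _; rewrite mxE.
pose G : 'M[R]_(n, m) := \matrix_(a, j) subm_val (g j) a 0.
have GE (v : 'cV[R]_m) : subm_val (\sum_j v j 0 *: g j) = G *m v.
  have [h hE] := linear_ex (@subm_linear _ _ _ (MA0 A) (@MAP A)).
  rewrite -hE linear_sum; apply/matrixP => a b; rewrite ord1 summxE mxE.
  by apply: eq_bigr => j _; rewrite linearZ /= hE !mxE mulrC.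
have c0G : map_mx (@c0 k i) G = 0.
  apply/matrixP => a j; rewrite !mxE; have [v <-] := cs (g j); rewrite cE.
  have -> : c0 ((Phi A *m v) a 0) = (map_mx (@c0 k i) (Phi A *m v)) a 0 by rewrite [RHS]mxE.
  by rewrite map_mxM c0_Phi mul0mx mxE.
have [C CE] : exists C : 'M[R]_(m, n), G *m C = Phi A.
  have [h hE] := choice (fun j => gen (c (delta_mx j 0))).
  exists (\matrix_(a, b) h b a 0); apply: mulmx_delta_ext => b.
  rewrite -cE hE GE -mulmxA; congr (_ *m _).
  by apply/matrixP => a a'; rewrite ord1 -colE !mxE.
have := congr1 (map_mx (@cX k i)) CE; rewrite map_cXM c0G mul0mx add0r cX_Phi => E.
rewrite -(mxrank1 k n) -E; apply: leq_trans (mxrankM_maxl _ _) _.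
exact: rank_leq_col.
Qed.

(* The projection onto a projective summand comes from an idempotent E of R^n with
   E (x - N) = 0; the x-coefficient gives E = 0 modulo the maximal ideal, so E is nilpotent. *)
Lemma MA_no_proj_summand A : no_proj_summand (MA A).
Proof.
move=> P Q [f [f' fK f'K]] Pproj; have [c cE [cs ck]] := MA_cover A.
have lp : linear (fun v : 'cV[R]_n => (f (c v)).1) by move=> a u v; rewrite !linearP.
have [p pE] := linear_ex lp.
have ps x : exists v, p v = x.
  by have [v vE] := cs (f' (x, 0)); exists v; rewrite pE vE f'K.
have [h hE] := Pproj _ _ p idfun ps.
have [E EE] := cV_matrix (h \o p : {linear _ -> _}).
have E2 : E *m E = E.
  apply: mulmx_delta_ext => j; rewrite -mulmxA -!EE /=; congr (h _); exact: hE.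
have EPhi : E *m Phi (- A) = 0.
  apply: mulmx_delta_ext => j; rewrite mul0mx -mulmxA -EE /= pE.
  have -> : c (Phi (- A) *m delta_mx j 0) = 0 by apply/ck; rewrite mulmxA PhiNM0 mul0mx.
  by rewrite linear0 linear0.
have c0E : map_mx (@c0 k i) E = 0.
  have := congr1 (map_mx (@cX k i)) EPhi.
  by rewrite map_cXM cX_Phi c0_Phi mulmx1 mulmx0 addr0 raddf0.
have cXE : map_mx (@cX k i) E = 0.
  by rewrite -E2 map_cXM c0E mul0mx mulmx0 addr0.
have cYE l : map_mx (cY l) E = 0.
  by rewrite -E2 map_cYM c0E mul0mx mulmx0 addr0.
have cXYE l : map_mx (cXY l) E = 0.
  by rewrite -E2 map_cXYM c0E cXE cYE !(mul0mx, mulmx0) !addr0.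
have E0 : E = 0.
  by apply/matrixP => a b; apply: coord_ext => [||l|l];
    [move/matrixP/(_ a b): c0E | move/matrixP/(_ a b): cXE |
     move/matrixP/(_ a b): (cYE l) | move/matrixP/(_ a b): (cXYE l)];
    rewrite !mxE raddf0.
move=> x; have hx : p (h x) = x := hE x.
have : h (p (h x)) = E *m h x := EE (h x).
by rewrite E0 mul0mx hx => hx0; rewrite -hx hx0 linear0.
Qed.

End ModuleOfMatrices.

(** * Isomorphisms and conjugation *)

Section Isomorphisms.
Variables (k : fieldType) (i n : nat).
Local Notation R := (ringS k i).
Implicit Types A B : {ffun 'I_i -> 'M[k]_n}.

(* Only the constant terms of G contribute to the coefficient of x y_l. *)
Lemma Phi_intertwine A B (G : 'M[R]_n) : Phi B *m G *m Phi (- A) = 0 ->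
  forall l, map_mx (@c0 k i) G *m A l = B l *m map_mx (@c0 k i) G.
Proof.
move=> E l; have := congr1 (map_mx (cXY l)) E.
rewrite raddf0 map_cXYM c0_Phi mulmx0 addr0 cX_Phi mulmx1 cY_Phi ffunE mulmxN.
rewrite map_mxM c0_Phi mul0mx mul0mx add0r map_cXM c0_Phi mul0mx add0r cX_Phi mul1mx.
rewrite map_cYM c0_Phi mul0mx add0r cY_Phi addrC => /eqP.
by rewrite subr_eq0 => /eqP.
Qed.

Lemma MA_iso A B : lmod_iso (MA A) (MA B) <-> sim_conj A B.
Proof.
have [cA cAE [sA kA]] := MA_cover A; have [cB cBE [sB kB]] := MA_cover B.
split=> [AB|[P Pu PAB]].
  have [G [G' [GE GE']]] := lmod_iso_cover sA sB AB.
  (* The composite of the lifts is the identity modulo ker (x + N); the x-coefficient of the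
     resulting matrix equation involves only constant terms. *)
  have GG : map_mx (@c0 k i) G' *m map_mx (@c0 k i) G = 1%:M.
    have : Phi A *m (G' *m G) = Phi A.
      apply: mulmx_delta_ext => v; apply/eqP.
      rewrite -subr_eq0 -!mulmxA -mulmxBr; apply/eqP/kA.
      by rewrite linearB GE' subrr.
    by move=> /(congr1 (map_mx (@cX k i))); rewrite map_cXM c0_Phi mul0mx add0r
      cX_Phi mul1mx map_mxM.
  have Gu : map_mx (@c0 k i) G \in unitmx by have [] := mulmx1_unit GG.
  exists (map_mx (@c0 k i) G) => // j.
  rewrite (@Phi_intertwine A B) ?mulmxK //.
  apply: mulmx_delta_ext => v; rewrite mul0mx -!mulmxA; apply/kB/GE/kA.
  by rewrite mulmxA PhiNM0 mul0mx.
pose Pm : 'M[R]_n := map_mx (@piC k i) P.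
pose Pi : 'M[R]_n := map_mx (@piC k i) (invmx P).
have PmK : Pi *m Pm = 1%:M by rewrite -map_mxM mulVmx // map_mx1.
have PiK : Pm *m Pi = 1%:M by rewrite -map_mxM mulmxV // map_mx1.
(* Conversely, a conjugating matrix over k already intertwines x + N for the two tuples. *)
have PPhi : Pm *m Phi A = Phi B *m Pm.
  rewrite !PhiE mulmxDl mulmxDr scalar_mxC; congr (_ + _).
  rewrite mulmx_sumr mulmx_suml; apply: eq_bigr => j _.
  by rewrite -scalemxAr -scalemxAl -!map_mxM -PAB mulmxKV.
apply: (lmod_iso_ker (g := (cB \o mulmx Pm : {linear 'cV[R]_n -> MA B})) sA).
  by move=> w; have [v <-] := sB w; exists (Pi *m v); rewrite /= mulmxA PiK mul1mx.
move=> v; split=> [/kA E|/kB E]; [apply/kB|apply/kA].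
  by rewrite mulmxA -PPhi -mulmxA E mulmx0.
by rewrite -[Phi A]mul1mx -PmK -[Pi *m Pm *m _]mulmxA PPhi -!mulmxA E mulmx0.
Qed.

End Isomorphisms.

(** * Freeness over Q *)

Section YProjection.
Variables (k : fieldType) (i : nat).
Local Notation R := (ringS k i).
Local Notation xS := (xS k i).
Local Notation yS := (@yS k i).
Local Notation mq0 := (map_mx (@q0 k i)).
Local Notation mq1 := (map_mx (@q1 k i)).
Local Notation mc0 := (map_mx (@c0 k i)).

(* The projection onto k y_j + k x y_j.  R-linear on the ideal (Y) only, see [yproj_mul]. *)
Definition yproj j (s : R) : R := piC i (cY j s) * yS j + xS * (piC i (cXY j s) * yS j).

Lemma coord_yproj j s : ((c0 (yproj j s) = 0) * (cX (yproj j s) = 0)) *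
  ((forall l, cY l (yproj j s) = cY j s * (l == j)%:R)
  * (forall l, cXY l (yproj j s) = cXY j s * (l == j)%:R)).
Proof.
by (do 2!split) => [||l|l]; rewrite /yproj !coordD !coordM ?coord_x ?coord_C ?coord_y;
  rewrite ?coordM ?coord_C ?coord_y; ring.
Qed.

Lemma yproj_mul j r s : c0 s = 0 -> cX s = 0 -> yproj j (r * s) = r * yproj j s.
Proof.
move=> s0 sX; apply: coord_ext => [||l|l]; rewrite !coordM !coord_yproj ?coordM ?s0 ?sX; ring.
Qed.

Lemma yprojD j s t : yproj j (s + t) = yproj j s + yproj j t.
Proof. by rewrite /yproj !coordD !rmorphD !mulrDl mulrDr addrACA. Qed.

Lemma yproj_y j s : yproj j s = (piC i (cY j s) + xS * piC i (cXY j s)) * yS j.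
Proof. by rewrite /yproj mulrDl mulrA. Qed.

(** The annihilator of each y_j is the whole ideal (Y), so membership in (Y) can be tested with any
    single y_j. *)
Lemma mul_y_eq0 s j : s * yS j = 0 <-> c0 s = 0 /\ cX s = 0.
Proof.
split=> [E|[s0 sX]].
  split; [have := congr1 (@cY k i j) E | have := congr1 (@cXY k i j) E];
  by rewrite raddf0 coordM !coord_y eqxx !(mulr0, mulr1, addr0, add0r).
by apply: coord_ext => [||l|l]; rewrite raddf0 coordM !coord_y ?s0 ?sX; ring.
Qed.

Lemma coord_q1 (s : R) : ((c0 (q1 s) = cX s) * (cX (q1 s) = 0)) *
  ((forall j, cY j (q1 s) = cXY j s) * (forall j, cXY j (q1 s) = 0)).
Proof. by (do 2!split) => [||l|l]; rewrite coord_Q. Qed.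

Lemma coord_q0 (s : R) : ((c0 (q0 s) = c0 s) * (cX (q0 s) = 0)) *
  ((forall j, cY j (q0 s) = cY j s) * (forall j, cXY j (q0 s) = 0)).
Proof. by (do 2!split) => [||l|l]; rewrite coord_Q. Qed.

Lemma q1_q0 (s : R) : q1 (q0 s) = 0.
Proof. by apply: coord_ext => [||l|l]; rewrite coord_q1 ?coord_q0 raddf0. Qed.
Lemma q1_q1 (s : R) : q1 (q1 s) = 0.
Proof. by apply: coord_ext => [||l|l]; rewrite !coord_q1 ?raddf0. Qed.

Lemma mq1_mq1 m n (A : 'M[R]_(m, n)) : mq1 (mq1 A) = 0.
Proof. by apply/matrixP => a b; rewrite !mxE q1_q1. Qed.
Lemma mq0_id m n (A : 'M[R]_(m, n)) : mq1 A = 0 -> mq0 A = A.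
Proof. by move=> A1; rewrite [RHS]mx_q01E A1 scaler0 addr0. Qed.

End YProjection.

Section QFreeness.
Variables (k : fieldType) (i : nat).
Local Notation R := (ringS k i).
Local Notation xS := (xS k i).
Local Notation yS := (@yS k i).
Local Notation mq0 := (map_mx (@q0 k i)).
Local Notation mq1 := (map_mx (@q1 k i)).
Local Notation mc0 := (map_mx (@c0 k i)).

Section Generators.
Variables (M : lmodType R) (t : nat) (p : {linear 'cV[R]_t -> M}).
(** Vectors with [mq1 q = 0] are those over Q; the two hypotheses say that [p] restricts to a
    minimal cover of M by Q^t. *)
Hypothesis gen : forall m, exists2 q : 'cV[R]_t, mq1 q = 0 & p q = m.
Hypothesis rel0 : forall q : 'cV[R]_t, mq1 q = 0 -> p q = 0 -> mc0 q = 0.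

Lemma x_matrix : exists2 N : 'M[R]_t, mq1 N = 0 &
  forall q, xS *: p q = p (N *m q).
Proof.
have gen' m : exists q : 'cV[R]_t, mq1 q = 0 /\ p q = m by have [q] := gen m; exists q.
have [N NE] := choice (fun j => gen' (xS *: p (delta_mx j 0))).
exists (\matrix_(a, b) N b a 0).
  apply/matrixP => a b; have [/matrixP/(_ a 0) + _] := NE b.
  by rewrite !mxE.
move=> q; rewrite {1}[q]cV_basis linear_sum scaler_sumr.
have -> : (\matrix_(a, b) N b a 0) *m q = \sum_j q j 0 *: N j.
  apply/matrixP => a b; rewrite ord1 summxE mxE.
  by apply: eq_bigr => j _; rewrite !mxE mulrC.
rewrite linear_sum; apply: eq_bigr => j _.
by rewrite !linearZ /= (proj2 (NE j)) !scalerA mulrC.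
Qed.

Variable N : 'M[R]_t.
Hypothesis N1 : mq1 N = 0.
Hypothesis NE : forall q, xS *: p q = p (N *m q).

Local Notation B := (xS%:M + N).

Lemma q1_xN m (w : 'M[R]_(t, m)) : mq1 (B *m w) = mq0 w + N *m mq1 w.
Proof.
have -> : mq1 (B *m w) = mq0 B *m mq1 w + mq1 B *m mq0 w by exact: map_q1M.
have -> : mq0 B = N by rewrite map_mxD map_scalar /= q0x raddf0 add0r; exact: mq0_id.
have -> : mq1 B = 1%:M by rewrite map_mxD map_scalar /= q1x N1 addr0.
by rewrite mul1mx addrC.
Qed.

(** Since x acts as N, the vector w = [q0] + x [q1] has the same image as [q0] + N [q1], which is
    over Q and is the [q1]-part of (x + N) w. *)
Lemma p_q1 w : p w = p (mq1 (B *m w)).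
Proof. by rewrite q1_xN {1}[w]mx_q01E addrC (linearP p) NE addrC -raddfD. Qed.

(** For w in the kernel, [p_q1] applied to w and to x w gives two relations over Q; by minimality
    they make the entries of (x + N) w lie in (Y). *)
Lemma ker_coord w : p w = 0 -> mc0 (B *m w) = 0 /\ map_mx (@cX k i) (B *m w) = 0.
Proof.
move=> w0; have /matrixP cXw : mc0 (mq1 (B *m w)) = 0.
  by apply: rel0; [exact: mq1_mq1 | rewrite -p_q1].
have pxw : p (xS *: w) = 0 by rewrite linearZ /= w0 scaler0.
have /matrixP c0w : mc0 (mq1 (B *m (xS *: w))) = 0.
  by apply: rel0; [exact: mq1_mq1 | rewrite -p_q1].
split; apply/matrixP => a b.
  move: (c0w a b); rewrite -scalemxAr !mxE.
  by rewrite coord_q1 coordM !coord_x mul0r mul1r add0r.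
by move: (cXw a b); rewrite !mxE coord_q1.
Qed.

(* A relation q <> 0 lies in (Y)Q^t, say with a nonzero y_j0-coefficient at a0.  The map
   L : F_1 -> R below takes values in (Y), and its x y_j0-coefficient detects q.  As
   y_j0 R is a quotient of R, yproj j0 \o L lifts to ta : F_1 -> R, which maps
   the 1-cycles into (Y); the cocycle yproj j0 \o ta \o d_1 cannot be a coboundary, since
   on (Y) yproj j0 fixes y_j0 and kills y_j1. *)
Lemma Ext2_free : (1 < i)%N -> Ext_eq0 2 M R^o ->
  forall q : 'cV[R]_t, mq1 q = 0 -> p q = 0 -> q = 0.
Proof.
move=> i2 [F vanish] q qQ pq0; have cq0 := rel0 qQ pq0.
have cqX : map_mx (@cX k i) q = 0.
  apply/matrixP => a b; move/matrixP/(_ a b): qQ; rewrite !mxE => qQ.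
  by rewrite -[LHS](coord_q1 _).1.1 qQ raddf0.
apply: contrapT => q_neq0.
have [a0 [j0 qaj]] : exists a j, cY j (q a 0) <> 0.
  apply: contrapT => noY; apply: q_neq0; apply/matrixP => a b; rewrite ord1 !mxE.
  apply: coord_ext => [||j|j]; rewrite raddf0.
  - by move/matrixP/(_ a 0): cq0; rewrite !mxE.
  - by move/matrixP/(_ a 0): cqX; rewrite !mxE.
  - by apply: contrapT => nY; apply: noY; exists a, j.
  - move/matrixP/(_ a 0): qQ; rewrite !mxE => qQ.
    by rewrite -[LHS](coord_q1 _).2.1 qQ raddf0.
(* The second variable, available because i >= 2. *)
have [j1 j10] : exists j1 : 'I_i, j1 != j0.
  have [/eqP j00|n0] := eqVneq (val j0) 0%N; last first.
    exists (Ordinal (ltnW i2)); apply: contraNneq n0 => <- //.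
  by exists (Ordinal i2); apply: contraTneq j00 => <-.
have psurj m : exists w, p w = m by have [w _ <-] := gen m; exists w.
(* [al] lifts the augmentation F_0 -> M to a map F_0 -> R^t. *)
have [al alE] := @res_proj _ _ F 0%N _ _ p (res_aug F) psurj.
have dd0 z : res_d F 0%N (res_d F 1%N z) = 0 by apply/res_exactS; exists z.
have dd1 z : res_d F 1%N (res_d F 2 z) = 0 by apply/res_exactS; exists z.
have augd z : p (al (res_d F 0%N z)) = 0.
  by rewrite alE; apply/res_exact0; exists z.
pose L z := (B *m al (res_d F 0%N z)) a0 0.
have L_lin a u v : L (a *: u + v) = a * L u + L v.
  by rewrite /L (linearP (res_d F 0%N)) (linearP al) mulmxDr -scalemxAr !mxE.
have cL z : c0 (L z) = 0 /\ cX (L z) = 0.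
  have [/matrixP/(_ a0 0) E0 /matrixP/(_ a0 0) EX] := ker_coord (augd z).
  by split; [move: E0 | move: EX]; rewrite [LHS]mxE [RHS]mxE.
(* The ideal R y_j0, onto which R maps by multiplication; projectivity of F_1 then lifts [yproj j0]
   of [L] to [ta]. *)
pose Y s := exists r, s = r * yS j0.
have Y0 : Y (0 : R^o) by exists 0; rewrite mul0r.
have YP a (u v : R^o) : Y u -> Y v -> Y (a *: u + v).
  by move=> [r ->] [r' ->]; exists (a * r + r'); rewrite mulrDl -mulrA.
have lps : linear (fun z => yproj j0 (L z) : R^o).
  by move=> a u v; rewrite L_lin yprojD yproj_mul; [|exact: (cL u).1|exact: (cL u).2].
have [ps psE] := linear_ex lps.
have psY z : Y (ps z) by rewrite psE yproj_y; eexists.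
have [ps' psE'] := @subm_lift _ _ _ Y0 YP _ ps psY.
have lmy : linear (fun r : R^o => r * yS j0 : R^o).
  by move=> a u v; rewrite mulrDl -scalerAl.
have [my myE] := linear_ex lmy.
have myY r : Y (my r) by rewrite myE; eexists.
have [my' myE'] := @subm_lift _ _ _ Y0 YP _ my myY.
have my_surj s : exists r, my' r = s.
  have [r rE] := submP s; exists r; apply: subm_inj.
  by rewrite myE' myE.
have [ta taE'] := @res_proj _ _ F 1%N _ _ my' ps' my_surj.
have taE z : ta z * yS j0 = yproj j0 (L z).
  by rewrite -psE -psE' -taE' myE' myE.
(* On boundaries [L] vanishes, so [ta] takes values in the annihilator of y_j0, which is (Y); there
   [yproj j0] is linear. *)
have cta z : c0 (ta (res_d F 1%N z)) = 0 /\ cX (ta (res_d F 1%N z)) = 0.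
  apply/(@mul_y_eq0 k i _ j0); rewrite taE /L dd0 linear0 mulmx0 mxE.
  by rewrite /yproj !raddf0 !mul0r mulr0 addr0.
have lf : linear (fun z => yproj j0 (ta (res_d F 1%N z)) : R^o).
  move=> a u v; rewrite (linearP (res_d F 1%N)) (linearP ta) yprojD yproj_mul;
    [by []|exact: (cta u).1|exact: (cta u).2].
have [f fE] := linear_ex lf.
have [|g gE] := vanish f.
  by move=> z; rewrite fE dd1 linear0 /yproj !raddf0 !mul0r mulr0 addr0.
have aug_surj m : exists y, res_aug F y = m by exact: res_aug_surj.
(* The relation q is transported to F_0: [ut] has augmentation p q = 0, hence bounds some [zh]. *)
have [vt vtE] := choice (fun a => aug_surj (p (delta_mx a 0))).
pose ut := \sum_a q a 0 *: vt a.
have [zh zhE] : exists z, res_d F 0%N z = ut.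
  apply/res_exact0; rewrite /ut linear_sum -[RHS]pq0 cV_linearE.
  by apply: eq_bigr => a _; rewrite linearZ /= vtE.
(* The entries of q lie in (Y), so y_l kills [ut] and y_l [zh] is a cycle. *)
have yz l : exists z, res_d F 1%N z = yS l *: zh.
  apply/res_exactS; rewrite linearZ /= zhE /ut scaler_sumr big1 // => a _.
  rewrite scalerA mulrC; have -> : q a 0 * yS l = 0; last exact: scale0r.
  apply/mul_y_eq0; move/matrixP/(_ a 0): cq0; move/matrixP/(_ a 0): cqX.
  by rewrite !mxE.
have gz l : yS l * g zh = yproj j0 (yS l * ta zh).
  have [z zE] := yz l; rewrite -[LHS]/(yS l *: (g zh : R^o)) -linearZ /= -zE -gE fE zE.
  by rewrite linearZ.
(* Taking l = j1 makes the right side of [gz] vanish, so [g zh] is annihilated by y_j1 and lies in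
   (Y). *)
have cg : c0 (g zh) = 0 /\ cX (g zh) = 0.
  apply/(@mul_y_eq0 k i _ j1); rewrite mulrC gz /yproj !coordM !coord_y.
  by rewrite eq_sym (negPf j10) !(mul0r, addr0, raddf0, mulr0).
(* Taking l = j0, the left side of [gz] vanishes while the right side retains the x y_j0-coefficient
   of [L zh]. *)
have cXYL : cXY j0 (L zh) = 0.
  have : g zh * yS j0 = 0 by apply/mul_y_eq0.
  rewrite mulrC gz [yS j0 * _]mulrC taE => /(congr1 (@cXY k i j0)).
  by rewrite raddf0 !coord_yproj eqxx !mulr1.
pose W : 'M[R]_t := \matrix_(a, b) al (vt b) a 0.
have WE : al ut = W *m q.
  rewrite /ut linear_sum; apply/matrixP => a b; rewrite ord1 summxE mxE.
  by apply: eq_bigr => j _; rewrite linearZ !mxE mulrC.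
(* Column b of [W] has the same image in M as the basis vector b. By [p_q1] and minimality, the
   [q1]-part of (x + N) W is the identity modulo (Y). *)
have cT : map_mx (@cX k i) (B *m W) = 1%:M.
  have T0 b : mc0 ((mq1 (B *m W) - 1%:M) *m (delta_mx b 0 : 'cV_t)) = 0.
    have Wb : W *m (delta_mx b 0 : 'cV_t) = al (vt b).
      by rewrite -colE; apply/matrixP => c d; rewrite ord1 !mxE.
    have Tb : mq1 (B *m W) *m (delta_mx b 0 : 'cV_t) = mq1 (B *m al (vt b)).
      by rewrite -Wb mulmxA -!colE; apply/matrixP => c d; rewrite !mxE.
    have d1 : mq1 (delta_mx b 0 : 'cV_t) = 0.
      by apply/matrixP => c d; rewrite !mxE raddfMn -(rmorph1 (@piC k i)) /= q1_C mul0rn.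
    rewrite mulmxBl mul1mx; apply: rel0; first by rewrite raddfB /= d1 Tb mq1_mq1 subr0.
    by rewrite linearB /= Tb -p_q1 alE vtE subrr.
  apply/matrixP => a b; move/matrixP/(_ a 0): (T0 b).
  rewrite -colE !mxE raddfB /= coord_q1 => /eqP; rewrite subr_eq0 => /eqP->.
  by rewrite raddfMn /= rmorph1.
(* As q has only y-coefficients, the x y_j0-coefficient of (x + N) W q is the y_j0-coefficient of q,
   contradicting the choice of [a0] and [j0]. *)
apply: qaj; have : map_mx (cXY j0) (B *m al ut) a0 0 = 0 by rewrite mxE -zhE.
rewrite WE mulmxA map_cXYM cq0 cqX !mulmx0 !addr0 cT mul1mx.
have -> : map_mx (cXY j0) q = 0.
  by apply/matrixP => a b; move/matrixP/(_ a b): qQ; rewrite !mxE => qQ;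
    rewrite -[LHS](coord_q1 _).2.1 qQ raddf0.
by rewrite mulmx0 add0r mxE.
Qed.

End Generators.
End QFreeness.

(** * From totally reflexive modules to matrices *)

Section Converse.
Variables (k : fieldType) (i : nat).
Local Notation R := (ringS k i).
Local Notation xS := (xS k i).
Local Notation yS := (@yS k i).
Local Notation mq0 := (map_mx (@q0 k i)).
Local Notation mq1 := (map_mx (@q1 k i)).
Local Notation mc0 := (map_mx (@c0 k i)).

Lemma Q_inv (s : R) : q1 s = 0 -> c0 s != 0 -> exists2 u, q1 u = 0 & u * s = 1.
Proof.
(* The inverse of a + n with n in (Y)Q is a^-1 - n a^-2, since n^2 = 0. *)
move=> sQ s0; pose u : R := mkQ (c0 s)^-1 (fun j => - (cY j s / c0 s ^+ 2)).
have [sX sXY] : cX s = 0 /\ forall j, cXY j s = 0.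
  split=> [|j]; first by rewrite -[LHS](coord_q1 _).1.1 sQ raddf0.
  by rewrite -[LHS](coord_q1 _).2.1 sQ raddf0.
exists u; first by apply: coord_ext => [||j|j]; rewrite coord_q1 ?coord_Q raddf0.
rewrite -(rmorph1 (@piC k i)).
apply: coord_ext => [||j|j]; rewrite coordM !coord_Q ?sX ?sXY !coord_C; field; exact: s0.
Qed.

(** After inverting [q0 s] in Q, a factor 1 + x r remains, with inverse 1 - x r because x^2 = 0. *)
Lemma c0_inv (s : R) : c0 s != 0 -> exists u, u * s = 1.
Proof.
move=> s0; have [u uQ us] : exists2 u, q1 u = 0 & u * q0 s = 1.
  by apply: Q_inv; [exact: q1_q0 | rewrite coord_q0].
exists ((1 - xS * (u * q1 s)) * u); rewrite {2}(q01E s) -mulrA mulrDr us.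
have -> : (1 - xS * (u * q1 s)) * (1 + u * (xS * q1 s))
  = 1 - xS * xS * ((u * q1 s) * (u * q1 s)) by ring.
by rewrite relS_xx mul0r subr0.
Qed.

Definition Q_gen (M : lmodType R) t (p : {linear 'cV[R]_t -> M}) : Prop :=
  forall m, exists2 q : 'cV[R]_t, mq1 q = 0 & p q = m.

(** Since R = Q + xQ, the R-generators together with their multiples by x generate over Q. *)
Lemma Q_generators (M : lmodType R) : fin_gen M ->
  exists t (p : {linear 'cV[R]_t -> M}), Q_gen p.
Proof.
case=> m [g gen]; pose gg (j : 'I_(m + m)) := match fintype.split j with
  inl a => g a | inr a => xS *: g a end.
have [p pE] := cV_linear_ex gg; exists (m + m)%N, p => w; have [c ->] := gen w.
exists (col_mx (\col_j q0 (c j)) (\col_j q1 (c j))).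
  apply/matrixP => a b; rewrite !mxE; case: fintype.split => a'; rewrite mxE.
    exact: q1_q0.
  exact: q1_q1.
rewrite pE big_split_ord /= -big_split /=; apply: eq_bigr => j _.
rewrite col_mxEu col_mxEd !mxE /gg -[lshift _ _]/(unsplit (inl j)).
rewrite -[rshift _ _]/(unsplit (inr j)) !unsplitK scalerA -scalerDl.
by rewrite {3}(q01E (c j)) [xS * _]mulrC.
Qed.

(** For the least possible t, a relation over Q with a unit coefficient would express one generator
    through the others and allow t - 1. *)
Lemma Q_min_generators (M : lmodType R) : fin_gen M ->
  exists t (p : {linear 'cV[R]_t -> M}), Q_gen p /\
    forall q : 'cV[R]_t, mq1 q = 0 -> p q = 0 -> mc0 q = 0.
Proof.
move=> /Q_generators Mfin; pose G t := `[< exists p : {linear 'cV[R]_t -> M}, Q_gen p >].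
have [t /asboolP[p pgen] tmin] := ex_minnP (P := G) (let: ex_intro t h := Mfin in
  ex_intro _ t (introT (asboolP _) h)).
exists t, p; split=> // q qQ pq0; apply: contrapT => cq.
have [a qa] : exists a, c0 (q a 0) != 0.
  apply: contrapT => na; apply: cq; apply/matrixP => a b; rewrite ord1 !mxE.
  by apply/eqP; apply: contrapT => /negP qa; apply: na; exists a.
have [u uQ uq] : exists2 u, q1 u = 0 & u * q a 0 = 1.
  by apply: Q_inv qa; move/matrixP/(_ a 0): qQ; rewrite !mxE.
case: t p pgen tmin q qQ pq0 cq a qa uq => [|t] p pgen tmin q qQ pq0 _ a _ uq.
  by case: a uq.
suff /tmin : G t by rewrite ltnn.
have [p' p'E] := cV_linear_ex (fun j => p (delta_mx (lift a j) 0)).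
apply/asboolP; exists p' => m; have [r rQ rE] := pgen m.
pose r' := r - (r a 0 * u) *: q.
have r'a : r' a 0 = 0 by rewrite !mxE -mulrA uq mulr1 subrr.
exists (\col_j r' (lift a j) 0).
  have q10 (z : 'cV[R]_t.+1) c : mq1 z = 0 -> q1 (z c 0) = 0.
    by move=> /matrixP/(_ c 0); rewrite !mxE.
  apply/matrixP => j b; rewrite !mxE raddfB /= !q1M !q10 // uQ.
  by rewrite !(mulr0, mul0r, addr0) subr0.
transitivity (p r'); last by rewrite linearB linearZ /= pq0 scaler0 subr0.
rewrite [RHS]cV_linearE (bigD1_ord a) //= r'a scale0r add0r p'E.
by apply: eq_bigr => j _; rewrite mxE.
Qed.

(** Freeness over Q identifies ker [p] with ker (x + N), and the absence of projective summands
    forces x + N to be some [Phi A]; then M and [MA A] are quotients of R^t by the same kernel. *)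
Lemma iso_MA (M : lmodType R) : (1 < i)%N -> fin_gen M -> Ext_eq0 2 M R^o ->
  no_proj_summand M ->
  exists t (A : {ffun 'I_i -> 'M[k]_t}), lmod_iso M (MA A).
Proof.
move=> i2 Mfin Mext Mnps; have [t [p [pgen rel0]]] := Q_min_generators Mfin.
have [N N1 NE] := x_matrix pgen; pose B := xS%:M + N.
have free := Ext2_free pgen rel0 N1 NE i2 Mext.
(* For w in ker [p], both Q-components of (x + N) w are relations over Q: the [q1]-part for w, the
   [q0]-part for x w. *)
have pB w : p w = 0 <-> B *m w = 0.
  split=> [w0|Bw0]; last by rewrite (p_q1 N1 NE) Bw0 raddf0 linear0.
  rewrite [LHS]mx_q01E.
  have -> : mq1 (B *m w) = 0.
    by apply: free; [exact: mq1_mq1 | rewrite -(p_q1 N1 NE)].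
  have -> : mq0 (B *m w) = mq1 (B *m (xS *: w)).
    rewrite -scalemxAr; apply/matrixP => a b; rewrite !mxE.
    by rewrite q1M q0x q1x mul0r mul1r add0r.
  rewrite scaler0 addr0; apply: free; first exact: mq1_mq1.
  by rewrite -(p_q1 N1 NE) linearZ /= w0 scaler0.
have psurj m : exists w, p w = m by have [w _ <-] := pgen m; exists w.
(* x + N factors through M. A unit entry would thus give a functional on M that takes the value
   1. *)
have c0N : mc0 N = 0.
  have [h hE] := linear_factor (f := p) (g := mulmx B : {linear 'cV[R]_t -> 'cV[R]_t})
    psurj (fun w => proj1 (pB w)).
  apply/matrixP => b a; rewrite !mxE; apply/eqP; apply: contrapT => /negP Nba.
  have [u uB] : exists u, u * B b a = 1.
    apply: c0_inv; rewrite !mxE coordD raddfMn /= coord_x mul0rn add0r.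
    exact: Nba.
  have lphi : linear (fun m => h m b 0 : R^o) by move=> c x y; rewrite linearP !mxE.
  have [phi phiE] := linear_ex lphi.
  apply: (@no_summand_functional _ _ phi (u *: p (delta_mx a 0)) Mnps).
  by rewrite linearZ /= phiE hE /= -colE mxE.
pose A : {ffun 'I_i -> 'M[k]_t} := [ffun j => map_mx (cY j) N].
have BE : B = Phi A.
  rewrite PhiE; congr (_ + _); rewrite -[LHS]mq0_id //; apply/matrixP => a b.
  rewrite summxE !mxE /q0 mkQE; move/matrixP/(_ a b): c0N; rewrite !mxE => ->.
  rewrite rmorph0 add0r; apply: eq_bigr => j _.
  by rewrite !mxE ffunE mxE mulrC.
have [cA cAE [sA kA]] := MA_cover A.
exists t, A; apply: (lmod_iso_ker psurj sA) => v.
by rewrite pB BE kA.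
Qed.

End Converse.

(** * Bijections between sets of classes *)

Lemma classes_inj (T : Type) (E : T -> T -> Prop) (C D : classes E) :
  sval C = sval D -> C = D.
Proof.
case: C D => [C Cx] [D Dx] /= CD; case: D / CD Dx => Dx.
by rewrite (Prop_irrelevance Cx Dx).
Qed.

(** The map sends a class to the class of [f] at a chosen representative; [f] need only be
    surjective up to [E']. *)
Lemma classes_bij (T U : Type) (E : T -> T -> Prop) (E' : U -> U -> Prop) (f : T -> U) :
  (forall u, E' u u) -> (forall u v, E' u v -> E' v u) ->
  (forall u v w, E' u v -> E' v w -> E' u w) ->
  (forall x y, E x y <-> E' (f x) (f y)) -> (forall u, exists x, E' (f x) u) ->
  exists theta : classes E -> classes E', bijective theta.
Proof.
move=> E'r E's E't Ef fs.
have E'eq u v : E' u v -> E' u = E' v.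
  by move=> uv; apply/funext => w; apply/propext; split; [apply/E't/E's|apply: E't].
have Eeq x y : E x y -> E x = E y.
  by move=> /Ef/E'eq fxy; apply/funext => z; apply/propext; split=> /Ef;
    [rewrite fxy | rewrite -fxy] => /Ef.
have [rep repE] := choice (fun C : classes E => proj2_sig C).
pose theta (C : classes E) : classes E' := exist _ (E' (f (rep C))) (ex_intro _ _ erefl).
exists theta; apply: inj_surj_bij => [C D CD|[D [u Du]]].
  have /Eeq rCD : E (rep C) (rep D).
    apply/Ef; have -> : E' (f (rep C)) = E' (f (rep D)) by exact: (congr1 sval CD).
    exact: E'r.
  by apply: classes_inj; rewrite !repE.
have [x xu] := fs u; pose C : classes E := exist _ (E x) (ex_intro _ x erefl).
exists C; apply: classes_inj; rewrite [RHS]/= Du; apply: E'eq; apply: (E't) xu.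
have /Ef : E x (rep C) by rewrite -[E x]/(sval C) repE; apply/Ef.
exact: E's.
Qed.

Local Close Scope ring_scope.

Theorem theorem3p6 (k : fieldType) (i n : nat)
    (char0 : [pchar k]%R =i pred0) (i_ge2 : 2 <= i) (n_gt0 : 0 < n) :
  exists theta : TR k i n -> classes (@sim_conj k i n), bijective theta.
Proof.
have rep (X : TRmod k i n) : exists A : {ffun 'I_i -> 'M[k]_n}, lmod_iso (sval X) (MA A).
  case: X => M /= [[Mfin Mext _ _] Mnps Mn].
  have [t [A MA_iso]] := iso_MA i_ge2 Mfin (Mext 2 isT) Mnps.
  (* The size t of the matrices equals n, both being the minimal number of generators. *)
  have tn := min_generated_uniq MA_iso Mn (MA_min_generated A).
  by case: t / tn A MA_iso => A; exists A.
have [f fE] := choice rep.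
pose TA (A : {ffun 'I_i -> 'M[k]_n}) : TRmod k i n := exist _ (MA A)
  (And3 (MA_totally_reflexive A) (@MA_no_proj_summand _ _ _ A) (MA_min_generated A)).
apply: (@classes_bij _ _ _ _ f).
- by move=> A; apply/MA_iso/lmod_iso_refl.
- by move=> A B /MA_iso/lmod_iso_sym/MA_iso.
- by move=> A B C /MA_iso AB /MA_iso BC; apply/MA_iso; exact: lmod_iso_trans AB BC.
- move=> X Y; split=> [XY|/MA_iso XY].
    apply/MA_iso; apply: lmod_iso_trans (lmod_iso_sym (fE X)) _.
    exact: lmod_iso_trans XY (fE Y).
  apply: lmod_iso_trans (fE X) _; apply: lmod_iso_trans XY _; exact: lmod_iso_sym (fE Y).
move=> A; exists (TA A); apply/MA_iso; exact: lmod_iso_sym (fE (TA A)).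
Qed.
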